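(* Let $\mathfrak{A}$ be a $C^*$-algebra, let $H$ be a Hilbert $\mathfrak{A}$-module, and let $\mathcal{L}(H)$ be the $C^*$-algebra of all adjointable operators on $H$. If $T\in\mathcal{L}(H)$ is normal (i.e. $T^*T=TT^*$), then $w(T)=\|T\|$.
   Context: A (right) Hilbert $\mathfrak{A}$-module $H$ is a right $\mathfrak{A}$-module with an $\mathfrak{A}$-valued inner product $\langle\cdot,\cdot\rangle$ (linear in the second variable, conjugate-linear in the first) that is complete in the norm $\|x\|=\sqrt{\|\langle x,x\rangle\|}$. For $T\in\mathcal{L}(H)$, $\|T\|$ is the operator norm, and the numerical radius of $T$ is $w(T)=\sup\{\|\langle Tx,x\rangle\| : x\in H,\ \|x\|=1\}$, where the norm of $\langle Tx,x\rangle$ is the norm of $\mathfrak{A}$. *)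

(* Defs.v *)
From HB Require Import structures.
From mathcomp Require Import all_boot all_order all_algebra.
From mathcomp Require Import complex.
From mathcomp Require Import all_classical all_reals all_analysis.

Set Implicit Arguments.
Unset Strict Implicit.
Unset Printing Implicit Defensive.

Import Order.TTheory GRing.Theory Num.Theory.
Import numFieldNormedType.Exports.

Local Open Scope classical_set_scope.
Local Open Scope ring_scope.
Local Open Scope complex_scope.

(* C*-algebras over R[i]. No unit is required, so the product cannot be the one
   of MathComp's ring structures, which are all unital. *)
HB.mixin Record isCStarAlgebra (R : realType) (A : Type)
    of CompleteNormedModule R[i] A := {
  cmul : A -> A -> A;
  cstar : A -> A;
  cmulA : associative cmul;
  cmulDl : forall a b c : A, cmul (a + b) c = cmul a c + cmul b c;
  cmulDr : forall a b c : A, cmul a (b + c) = cmul a b + cmul a c;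
  cmulZl : forall (k : R[i]) (a b : A), cmul (k *: a) b = k *: cmul a b;
  cmulZr : forall (k : R[i]) (a b : A), cmul a (k *: b) = k *: cmul a b;
  cstarK : involutive cstar;
  cstarD : forall a b : A, cstar (a + b) = cstar a + cstar b;
  cstarZ : forall (k : R[i]) (a : A), cstar (k *: a) = k^* *: cstar a;
  cstarM : forall a b : A, cstar (cmul a b) = cmul (cstar b) (cstar a);
  cnormM : forall a b : A, `|cmul a b| <= `|a| * `|b|;
  cnorm_star_mul : forall a : A, `|cmul (cstar a) a| = `|a| ^+ 2
}.

#[short(type="cstarAlgType")]
HB.structure Definition CStarAlgebra (R : realType) :=
  {A of isCStarAlgebra R A & CompleteNormedModule R[i] A}.

(* In a C*-algebra these are exactly the self-adjoint elements with nonnegative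
   spectrum. *)
Definition cpositive (R : realType) (A : cstarAlgType R) (a : A) : Prop :=
  exists b : A, a = cmul (cstar b) b.

(* Right Hilbert A-modules. The norm of H is not an independent datum: it is
   the one of the inner product by hnormE, so that the completeness of H is
   completeness in that norm. Conjugate-linearity of the inner product in its
   first argument follows from the axioms hinnerD, hinnerZ and hinnerC. *)
HB.mixin Record isHilbertModule (R : realType) (A : cstarAlgType R) (H : Type)
    of CompleteNormedModule R[i] H := {
  ract : H -> A -> H;
  ractDl : forall (x y : H) (a : A), ract (x + y) a = ract x a + ract y a;
  ractDr : forall (x : H) (a b : A), ract x (a + b) = ract x a + ract x b;
  ractA : forall (x : H) (a b : A), ract x (cmul a b) = ract (ract x a) b;
  ractZl : forall (k : R[i]) (x : H) (a : A),
    ract (k *: x) a = k *: ract x a;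
  ractZr : forall (k : R[i]) (x : H) (a : A),
    ract x (k *: a) = k *: ract x a;
  hinner : H -> H -> A;
  hinnerD : forall x y z : H, hinner x (y + z) = hinner x y + hinner x z;
  hinnerZ : forall (k : R[i]) (x y : H), hinner x (k *: y) = k *: hinner x y;
  hinner_ract : forall (x y : H) (a : A),
    hinner x (ract y a) = cmul (hinner x y) a;
  hinnerC : forall x y : H, hinner y x = cstar (hinner x y);
  hinner_ge0 : forall x : H, cpositive (hinner x x);
  hinner_eq0 : forall x : H, hinner x x = 0 -> x = 0;
  hnormE : forall x : H, `|x| = sqrtC `|hinner x x|
}.

#[short(type="hilbertModType")]
HB.structure Definition HilbertModule (R : realType) (A : cstarAlgType R) :=
  {H of isHilbertModule R A H & CompleteNormedModule R[i] H}.

Section AdjointableOperators.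
Context (R : realType) (A : cstarAlgType R) (H : hilbertModType A).

Definition is_adjoint (T S : H -> H) : Prop :=
  forall x y : H, hinner (T x) y = hinner x (S y).

(* L(H). Linearity and boundedness are not required: both follow from the
   existence of an adjoint. *)
Record adjointable := Adjointable {
  adj_fun :> H -> H;
  adj_funP : exists S : H -> H, is_adjoint adj_fun S
}.

(* The adjoint is unique, so the choice made by cid is immaterial. *)
Definition adjoint_fun (T : adjointable) : H -> H := projT1 (cid (adj_funP T)).

Lemma adjoint_funP (T : adjointable) : is_adjoint T (adjoint_fun T).
Proof. exact: projT2 (cid (adj_funP T)). Qed.

Lemma adjoint_fun_adjointable (T : adjointable) :
  exists S : H -> H, is_adjoint (adjoint_fun T) S.
Proof.
by exists T => x y; rewrite hinnerC -adjoint_funP -hinnerC.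
Qed.

Definition adjoint (T : adjointable) : adjointable :=
  Adjointable (adjoint_fun_adjointable T).

Lemma comp_adjointable (T U : adjointable) :
  exists S : H -> H, is_adjoint (T \o U) S.
Proof.
by exists (adjoint U \o adjoint T) => x y /=; rewrite !adjoint_funP.
Qed.

Definition adjointable_comp (T U : adjointable) : adjointable :=
  Adjointable (comp_adjointable T U).

Definition normal_operator (T : adjointable) : Prop :=
  adjointable_comp (adjoint T) T = adjointable_comp T (adjoint T).

End AdjointableOperators.

(* Norms over R[i] take their values in R[i]; they are nonnegative reals, so
   the real part loses nothing and gives the norm as an element of R. *)
Definition rnorm (R : realType) (V : normedModType R[i]) (v : V) : R :=
  complex.Re `|v|.

(* This set and the one of numerical_radius are bounded above, since adjointable
   operators are bounded; so sup is the actual supremum. *)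
Definition operator_norm (R : realType) (A : cstarAlgType R)
    (H : hilbertModType A) (T : adjointable H) : R :=
  sup [set rnorm (T x) | x in [set x : H | rnorm x <= 1]].

(* For H = 0 the set is empty, and the sup of the empty set is 0. *)
Definition numerical_radius (R : realType) (A : cstarAlgType R)
    (H : hilbertModType A) (T : adjointable H) : R :=
  sup [set rnorm (hinner (T x) x) | x in [set x : H | rnorm x = 1]].

(* Main.v *)
Require Import Defs.
From HB Require Import structures.
From mathcomp Require Import all_boot all_order all_algebra.
From mathcomp Require Import complex.
From mathcomp Require Import all_classical all_reals all_analysis.
From mathcomp Require Import ring lra.

(** The inequality [w(T) <= |T|] is the Cauchy-Schwarz inequality. For the other
    one, let [N = |T|], and suppose [w(T) < N]. For [|k| = N], Cauchy-Schwarz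
    gives [|(T - k) x| |x| >= |<(T - k) x, x>| >= (N - w(T)) |x|^2], so that
    [T - k] is bounded below uniformly on the circle of radius [N]. This is
    impossible for a normal [T]: the norm of a normal operator is the modulus of
    an approximate eigenvalue ([norm_in_approx_spectrum]).

    That fact is proved without resolvents. Say [N = 1]. Lower bounds for
    [T - k] on the whole unit circle make the powers of [T] small
    ([doubling]), so the spectral radius of [T] is less than 1. But a normal
    operator of spectral radius less than 1 is a mean of unitary functions of
    itself, so its norm is at most its spectral radius
    ([contractive_of_iter]); as that is strict, [|T| < 1], a contradiction. Both
    steps only use the norm, and the hypothesis that [T - k] and its adjoint have
    equal norms at each vector.

    Cauchy-Schwarz rests on [|c|^2 <= |c^* c + d^* d|] in a C*-algebra
    ([rnorm_sqr_le_sum]), hence on the positivity of [b^* b]. It is obtained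
    from the same approximate eigenvalues, for the operators of left
    multiplication by self-adjoint elements ([lower_star_mul]).

    Finally, the two suprema are meaningful because adjointable operators are
    bounded, by a gliding hump argument ([adjointable_bounded]). *)

Set Implicit Arguments.
Unset Strict Implicit.
Unset Printing Implicit Defensive.

Import Order.TTheory GRing.Theory Num.Theory.
Import numFieldNormedType.Exports.

Local Open Scope classical_set_scope.
Local Open Scope complex_scope.
Local Open Scope ring_scope.

(** * The norm with real values *)

Section RealNorm.
Context (R : realType) (V : normedModType R[i]).
Implicit Types (u v : V) (k : R[i]) (r : R).

Lemma normE v : `|v| = (rnorm v)%:C.
Proof. by rewrite /rnorm RRe_real// ger0_real. Qed.

Lemma rnorm_ge0 v : 0 <= rnorm v.
Proof. by rewrite -ler0c -normE. Qed.

Lemma rnorm_neq0_gt0 v : rnorm v != 0 -> 0 < rnorm v.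
Proof. by move=> v0; rewrite lt_neqAle eq_sym v0 rnorm_ge0. Qed.

Lemma rnorm_eq0 v : rnorm v = 0 -> v = 0.
Proof. by move=> v0; apply/normr0_eq0; rewrite normE v0. Qed.

Lemma rnorm0 : rnorm (0 : V) = 0.
Proof. by rewrite /rnorm normr0. Qed.

Lemma rnormN v : rnorm (- v) = rnorm v.
Proof. by rewrite /rnorm normrN. Qed.

Lemma rnormB u v : rnorm (u - v) = rnorm (v - u).
Proof. by rewrite /rnorm distrC. Qed.

Lemma rnormZ k v : rnorm (k *: v) = complex.Re `|k| * rnorm v.
Proof.
rewrite /rnorm normrZ normE.
by rewrite -{1}(RRe_real (ger0_real (normr_ge0 k))) -rmorphM.
Qed.

Lemma rnormZu k v : `|k| = 1 -> rnorm (k *: v) = rnorm v.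
Proof. by move=> k1; rewrite rnormZ k1 mul1r. Qed.

Lemma rnormZr r v : rnorm (r%:C *: v) = `|r| * rnorm v.
Proof. by rewrite rnormZ normc_def /= expr0n addr0 sqrtr_sqr. Qed.

Lemma rnormZp r v : 0 <= r -> rnorm (r%:C *: v) = r * rnorm v.
Proof. by move=> r0; rewrite rnormZr ger0_norm. Qed.

Lemma rnorm_leD u v : rnorm (u + v) <= rnorm u + rnorm v.
Proof.
rewrite -lecR; have -> : (rnorm u + rnorm v)%:C = `|u| + `|v|.
  by rewrite !normE -rmorphD.
by rewrite -normE ler_normD. Qed.

Lemma rnorm_leB u v : rnorm (u - v) <= rnorm u + rnorm v.
Proof. by rewrite -(rnormN v) rnorm_leD. Qed.

Lemma rnorm_subadd u v : rnorm u <= rnorm v + rnorm (u - v).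
Proof. by rewrite -{1}(subrKC v u) rnorm_leD. Qed.

Lemma rnorm_gt0_of_lt u v r : rnorm u < r * rnorm v -> 0 < rnorm v.
Proof.
move=> uv; apply: rnorm_neq0_gt0; apply/eqP => v0.
by move: uv; rewrite v0 mulr0 ltNge rnorm_ge0.
Qed.

End RealNorm.

Section ComplexNumbers.
Context (R : realType).

Lemma normCi : `|'i%C : R[i]| = 1.
Proof. by rewrite normc_def/= expr0n expr1n add0r sqrtr1. Qed.

Lemma norm_real_complex (r : R) : `|r%:C| = `|r|%:C :> R[i].
Proof. by rewrite normc_def/= expr0n addr0 sqrtr_sqr. Qed.

Lemma norm_sqrtC_unit (k : R[i]) : `|k| = 1 -> `|sqrtC k| = 1.
Proof.
by move=> k1; apply/eqP; rewrite -(@eqrXn2 _ 2)// ?expr1n -?normrX ?sqrtCK ?k1.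
Qed.

Lemma conjCM (a b : R[i]) : (a * b)^* = a^* * b^*.
Proof. exact: (rmorphM (@Num.conj R[i])). Qed.

Lemma conj_real (r : R) : (r%:C)^* = r%:C :> R[i].
Proof. exact: conjc_real. Qed.

End ComplexNumbers.


(** * Identities between vectors *)

(** Normalizing both sides of an equation to combinations of the same four
    vectors reduces it to four equations between scalars; the tactic [vector]
    does this for the vectors it is given. *)
Definition lincomb (R : realType) (V : lmodType R[i]) (a b c d : V)
  (x y z t : R[i]) : V := x *: a + y *: b + z *: c + t *: d.

Section Lincomb.
Context (R : realType) (V : lmodType R[i]) (a b c d : V).
Implicit Types x y z t k : R[i].
Notation lc := (lincomb a b c d).

Lemma lincombD x y z t x' y' z' t' :
  lc x y z t + lc x' y' z' t' = lc (x + x') (y + y') (z + z') (t + t').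
Proof.
rewrite /lincomb !scalerDl addrACA; congr (_ + _).
by rewrite addrACA; congr (_ + _); rewrite addrACA.
Qed.

Lemma lincombZ k x y z t : k *: lc x y z t = lc (k * x) (k * y) (k * z) (k * t).
Proof. by rewrite /lincomb !scalerDr !scalerA. Qed.

Lemma lincombN x y z t : - lc x y z t = lc (- x) (- y) (- z) (- t).
Proof. by rewrite /lincomb !scaleNr !opprD. Qed.

Lemma lincomb_ind (P : V -> V -> V -> V -> Prop) :
  P (lc 1 0 0 0) (lc 0 1 0 0) (lc 0 0 1 0) (lc 0 0 0 1) -> P a b c d.
Proof. by rewrite /lincomb !scale0r !scale1r !addr0 !add0r. Qed.
End Lincomb.

Ltac vector a b c d :=
  pattern a, b, c, d; apply: lincomb_ind; cbv beta;
  rewrite ?(lincombD, lincombZ, lincombN); congr (lincomb _ _ _ _ _ _ _ _); ring.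

(** * Approximate eigenvalues of normal maps *)

Section Doubling.
Context (R : realType) (V : normedModType R[i]).

Definition shift (f : V -> V) (k : R[i]) (v : V) : V := f v - k *: v.

Lemma shift_mul_opp (f : {linear V -> V}) k v :
  shift f k (shift f (- k) v) = shift (f \o f) (k ^+ 2) v.
Proof.
rewrite /shift /= linearB linearZ/=.
by move: (f v) (f (f v)) => b a; vector a b v v.
Qed.

Lemma shift_sqr_sub (f : {linear V -> V}) k v :
  shift f (- k) (shift f (- k) v) - shift f k (shift f k v) =
  (4 * k) *: f v.
Proof.
rewrite /shift /= !linearB !linearZ/=.
by move: (f v) (f (f v)) => b a; vector a b v v.
Qed.

Lemma rnorm_shift (f : V -> V) k v : (forall v, rnorm (f v) <= rnorm v) ->
  `|k| = 1 -> rnorm (shift f k v) <= 2 * rnorm v.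
Proof.
move=> f1 k1; have := rnorm_leB (f v) (k *: v); rewrite rnormZu// -/(shift f k v).
by have := f1 v; lra.
Qed.

(** For [g] the identity: if [(f - k)^2] is bounded below on the whole unit
    circle, then the powers of [f] decay like the inverse of their exponent. In an
    algebra this comes from summing the resolvent identity
    [k / (f - k)^2 - k / (f + k)^2 = 4 k^2 f / (f^2 - k^2)^2], which passes a
    bound for the pair [(f, g)] to the pair [(f^2, 2 g f)]. Applying the bounds
    for [k] and [- k] to [(f + k)^2 u] and [(f - k)^2 u] gives the same step
    without inverting anything: the halving of [K] against the doubling of the
    exponent is what produces the factor [2 ^+ m]. *)
Lemma doubling (m : nat) (f g : {linear V -> V}) (K : R) : 0 <= K ->
    (forall v, rnorm (f v) <= rnorm v) ->
    (forall k v, `|k| = 1 ->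
      rnorm (g v) <= K * rnorm (shift f k (shift f k v))) ->
  forall v, 2 ^+ m * rnorm (g (iter (2 ^ m).-1 f v)) <= 4 * K * rnorm v.
Proof.
elim: m f g K => [|m IH] f g K K0 f1 fg v.
  rewrite expn0 /= expr0 mul1r; apply: le_trans (fg 1 v (normr1 _)) _.
  rewrite -mulrA mulrCA ler_wpM2l//.
  have := rnorm_shift (shift f 1 v) f1 (normr1 _).
  by have := rnorm_shift v f1 (normr1 _); lra.
have -> : iter (2 ^ m.+1).-1 f v = f (iter (2 ^ m).-1 (f \o f) v).
  have -> : (2 ^ m.+1).-1 = (((2 ^ m).-1).*2).+1.
    by rewrite expnS mul2n -{1}(prednK (expn_gt0 2 m)) doubleS.
  rewrite iterS; congr (f _).
  by elim: (_.-1) => //= n ->.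
suff: forall v, 2 ^+ m * rnorm ((g \o f) (iter (2 ^ m).-1 (f \o f) v)) <=
    4 * (K / 2) * rnorm v.
  by move=> /(_ v) /=; rewrite exprS; lra.
apply: IH => [|u|k u k1].
- by rewrite divr_ge0.
- exact: le_trans (f1 _) (f1 _).
set l := sqrtC k; have lk : l ^+ 2 = k by exact: sqrtCK.
have l1 : `|l| = 1 by exact: norm_sqrtC_unit.
have comm w : shift f (- l) (shift f l w) = shift f l (shift f (- l) w).
  by rewrite -{2}(opprK l) !shift_mul_opp sqrrN.
(* the two square factors for l and - l multiply to the one for k *)
have /= sq w : shift f l (shift f l (shift f (- l) (shift f (- l) w))) =
    shift (f \o f) k (shift (f \o f) k w).
  by rewrite -lk -!shift_mul_opp comm.
have sq' w : shift f (- l) (shift f (- l) (shift f l (shift f l w))) =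
    shift (f \o f) k (shift (f \o f) k w).
  by rewrite -sq !comm.
have l1' : `|- l| = 1 by rewrite normrN.
have h1 := fg l (shift f (- l) (shift f (- l) u)) l1.
have h2 := fg (- l) (shift f l (shift f l u)) l1'.
rewrite sq in h1; rewrite sq' in h2.
have := rnorm_leB (g (shift f (- l) (shift f (- l) u)))
  (g (shift f l (shift f l u))).
rewrite -linearB shift_sqr_sub linearZ/= -scalerA.
have -> : (4 : R[i]) = 4%:C by rewrite rmorph_nat.
by rewrite rnormZp// rnormZu//; lra.
Qed.
End Doubling.

Section SpectralRadius.
Context (R : realType) (V : normedModType R[i]).

Lemma sum_even_odd (F : nat -> V) n :
  \sum_(0 <= i < n.*2) F i = \sum_(0 <= i < n) (F i.*2 + F i.*2.+1).
Proof.
elim: n => [|n IH]; first by rewrite !big_geq.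
by rewrite doubleS !big_nat_recr//= IH addrA.
Qed.

(** Cauchy's estimate for the constant coefficient, by averaging over the
    [2 ^ m]-th roots of unity: averaging over [l] and [- l] only keeps the even
    coefficients, and leaves a polynomial in [l ^+ 2] of half the size. *)
Lemma coef0_le_pow2 m (a : nat -> V) (B : R) :
    (forall k, `|k| = 1 -> rnorm (\sum_(0 <= i < 2 ^ m) k ^+ i *: a i) <= B) ->
  rnorm (a 0) <= B.
Proof.
elim: m a => [|m IH] a aB.
  by have := aB 1 (normr1 _); rewrite expn0 big_nat1 expr0 scale1r.
apply: (IH (a \o double)) => k k1.
set l := sqrtC k; have lk : l ^+ 2 = k by exact: sqrtCK.
have l1 : `|l| = 1 by exact: norm_sqrtC_unit.
have l1' : `|- l| = 1 by rewrite normrN.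
have even : \sum_(0 <= i < 2 ^ m.+1) l ^+ i *: a i
    + \sum_(0 <= i < 2 ^ m.+1) (- l) ^+ i *: a i
    = 2%:C *: \sum_(0 <= i < 2 ^ m) k ^+ i *: (a \o double) i.
  rewrite expnS mul2n -big_split/= sum_even_odd scaler_sumr.
  apply: eq_bigr => i _ /=.
  rewrite -mul2n !(exprS _ (2 * i)) !exprM sqrrN lk.
  rewrite -!scalerDl.
  rewrite subrr !scale0r addr0.
  by rewrite scalerA; congr (_ *: _); rewrite rmorph_nat; ring.
have := rnorm_leD (\sum_(0 <= i < 2 ^ m.+1) l ^+ i *: a i)
  (\sum_(0 <= i < 2 ^ m.+1) (- l) ^+ i *: a i).
rewrite even rnormZp//.
by have := aB l l1; have := aB _ l1'; lra.
Qed.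

Lemma coef0_le n (a : nat -> V) (B : R) :
    (forall k, `|k| = 1 -> rnorm (\sum_(0 <= i < n.+1) k ^+ i *: a i) <= B) ->
  rnorm (a 0) <= B.
Proof.
move=> aB; have n2 : (n < 2 ^ n)%N by exact: ltn_expl.
apply: (@coef0_le_pow2 n (fun i => if (i < n.+1)%N then a i else 0)) => k k1.
rewrite (big_cat_nat _ n2)//= [X in _ + X]big_nat_cond.
rewrite [X in _ + X]big1 => [|i]; last first.
  by case/andP => /andP[ni _] _; rewrite ltnNge ni scaler0.
rewrite addr0 big_nat_cond (eq_bigr (fun i => k ^+ i *: a i)).
  by rewrite -big_nat_cond; exact: aB.
by move=> i /andP[/andP[_ ->]].
Qed.

(** If [S] is the adjoint of a normal operator [T], then [T - k] and its
    adjoint have equal norms at each vector. In this form, normality makes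
    sense on a normed space without inner product. *)
Definition normal_pair (T S : V -> V) :=
  forall k v, rnorm (shift T k v) = rnorm (shift S (k^*) v).

Section NormalPair.
Variables T S : {linear V -> V}.
Hypothesis TS : normal_pair T S.

Lemma rnorm_normal_pair v : rnorm (S v) = rnorm (T v).
Proof. by have := TS 0 v; rewrite /shift conjC0 !scale0r !subr0. Qed.

(** For a scalar [T] of modulus below 1 with conjugate [S], the function
    [(S - k) / (1 - k T)] of [k] is unimodular on the unit circle and has mean
    [S] there. For a normal [T], [(S - k) y] and [(1 - k T) y] have the same
    norm when [|k| = 1]; if [y] is the truncated Neumann series of
    [(1 - k T)^-1 v], the second is [v - k^n T^n v], and the first is a
    polynomial in [k] with constant coefficient [S v]. *)
Lemma rnorm_le_iter n v : rnorm (T v) <= rnorm v + rnorm (iter n.+1 T v).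
Proof.
rewrite -rnorm_normal_pair.
(* the coefficients of (S - k) y as a polynomial in k *)
pose b i := (if (i < n.+1)%N then S (iter i T v) else 0) -
  (if i is j.+1 then iter j T v else 0).
have -> : S v = b 0 by rewrite /b/= subr0.
apply: (@coef0_le n.+1) => k k1.
have kk : k^* * k = 1.
  by have := normCKC k; rewrite k1 expr1n.
pose y := \sum_(0 <= i < n.+1) k ^+ i *: iter i T v.
have -> : \sum_(0 <= i < n.+2) k ^+ i *: b i = shift S k y.
  rewrite /shift /b.
  under eq_bigr do rewrite scalerBr.
  rewrite sumrB; congr (_ - _).
    rewrite big_nat_recr//= ltnn scaler0 addr0 /y linear_sum !big_nat.
    by apply: eq_bigr => i /andP[_ ->]; rewrite linearZ.
  rewrite big_nat_recl//= scaler0 add0r /y scaler_sumr.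
  by apply: eq_bigr => i _; rewrite exprS scalerA.
have -> : rnorm (shift S k y) = rnorm (shift T (k^*) y) by rewrite TS conjCK.
have -> : shift T (k^*) y = - k^* *: (v - k ^+ n.+1 *: iter n.+1 T v).
  rewrite /shift.
  have -> : T y = k^* *: \sum_(0 <= i < n.+1) k ^+ i.+1 *: iter i.+1 T v.
    rewrite /y linear_sum scaler_sumr; apply: eq_bigr => i _.
    by rewrite linearZ/= exprS scalerA mulrA kk mul1r.
  rewrite -scalerBr scaleNr -scalerN opprB; congr (_ *: _).
  have -> : y = v + \sum_(0 <= i < n) k ^+ i.+1 *: iter i.+1 T v.
    by rewrite /y big_nat_recl//= expr0 scale1r.
  rewrite big_nat_recr//=; move: (\sum_(0 <= i < n) _) (_ *: _) => s t.
  by vector s t v v.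
rewrite rnormZu ?normrN ?norm_conjC//.
have := rnorm_leB v (k ^+ n.+1 *: iter n.+1 T v).
by rewrite rnormZu// normrX k1 expr1n.
Qed.

(** A normal map has norm at most its spectral radius: the term with the
    iterate in the previous estimate can be made arbitrarily small. *)
Lemma contractive_of_iter p (q : R) : (0 < p)%N -> q < 1 ->
  (forall v, rnorm (iter p T v) <= q * rnorm v) ->
  forall v, rnorm (T v) <= rnorm v.
Proof.
move=> p0 q1 Tq v.
have [q0|q0] := ltP q 0.
  have v0 : rnorm v = 0.
    by have := Tq v; have := rnorm_ge0 v; have := rnorm_ge0 (iter p T v); nra.
  by rewrite (rnorm_eq0 v0) linear0.
have Tqk k : rnorm (iter (k * p) T v) <= q ^+ k * rnorm v.
  elim: k => [|k IH]; first by rewrite mul0n expr0 mul1r.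
  rewrite mulSn iterD exprS -mulrA.
  by apply: le_trans (Tq _) _; rewrite ler_wpM2l.
apply/ler_addgt0Pr => e e0.
have : (fun k => q ^+ k * rnorm v) @ \oo --> (0 : R).
  rewrite -(mul0r (rnorm v)); apply: cvgMl.
  by apply: cvg_expr; rewrite ger0_norm.
move=> /cvgrPdist_lt/(_ e e0)[k _ /(_ k.+1 (leqnSn k))].
rewrite sub0r normrN ger0_norm ?mulr_ge0 ?exprn_ge0 ?rnorm_ge0// => ke.
have kp : (0 < k.+1 * p)%N by rewrite muln_gt0.
have := rnorm_le_iter (k.+1 * p).-1 v; rewrite prednK//.
by have := Tqk k.+1; lra.
Qed.

End NormalPair.
End SpectralRadius.

Section NormAttained.
Context (R : realType) (V : normedModType R[i]).

Lemma bernoulli_ineq (x : R) n : 0 <= x <= 1 -> 1 - n%:R * x <= (1 - x) ^+ n.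
Proof.
move=> /andP[x0 x1]; elim: n => [|n IH]; first by rewrite mul0r subr0 expr0.
have n0 : 0 <= n%:R :> R by [].
have : (1 - x) * (1 - n%:R * x) <= (1 - x) * (1 - x) ^+ n.
  by rewrite ler_wpM2l// subr_ge0.
by rewrite exprS -natr1; apply: le_trans; nra.
Qed.

Lemma shift_scale (f : {linear V -> V}) (c k : R[i]) v :
  shift (c \*: f) (c * k) v = c *: shift f k v.
Proof. by rewrite /shift/= scalerBr scalerA. Qed.

Lemma normal_pair_scale (T S : {linear V -> V}) (c : R) : 0 < c ->
  normal_pair T S -> normal_pair (c%:C \*: T) (c%:C \*: S).
Proof.
move=> c0 TS k v.
have cN0 : c%:C != 0 by rewrite eq_complex/= eqxx andbT gt_eqF.
have ck : k = c%:C * (c%:C^-1 * k) by rewrite mulrA divff ?mul1r.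
by rewrite ck conjCM conj_real !shift_scale !rnormZ TS.
Qed.

Lemma iter_scale (f : {linear V -> V}) (c : R[i]) n v :
  iter n (c \*: f) v = c ^+ n *: iter n f v.
Proof.
elim: n => [|n IH]; first by rewrite scale1r.
by rewrite !iterS IH/= linearZ/= scalerA exprS.
Qed.

(** By [doubling], some power of [T] has norm at most 1/4, so the spectral
    radius is below 1, and for a normal map the norm is too. *)
Lemma strict_contraction (T S : {linear V -> V}) (d : R) :
    normal_pair T S -> 0 < d -> (forall v, rnorm (T v) <= rnorm v) ->
    (forall k v, `|k| = 1 -> d * rnorm v <= rnorm (shift T k v)) ->
  exists2 r, 0 < r < 1 & forall v, rnorm (T v) <= r * rnorm v.
Proof.
move=> TS d0 T1 Td.
pose K := d^-1 ^+ 2.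
have K0 : 0 <= K by rewrite exprn_ge0// invr_ge0 ltW.
have TK k v : `|k| = 1 ->
    rnorm (idfun v) <= K * rnorm (shift T k (shift T k v)).
  move=> k1 /=.
  have h1 := Td k v k1; have h2 := Td k (shift T k v) k1.
  rewrite /K exprVn -ler_pdivrMl ?invr_gt0 ?exprn_gt0// invrK.
  apply: le_trans h2; rewrite expr2 -mulrA ler_wpM2l//; exact: ltW.
have [m mK] : exists m, 16 * K <= 2 ^+ m.
  exists (Num.truncn (16 * K)).+1.
  apply: (@le_trans _ _ (Num.truncn (16 * K)).+1%:R).
    by rewrite ltW// truncnS_gt.
  by rewrite -natrX ler_nat ltnW// ltn_expl.
set p := (2 ^ m)%N; have p0 : (0 < p)%N by rewrite expn_gt0.
have pR : p%:R = 2 ^+ m :> R by rewrite natrX.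
have Tp v : rnorm (iter p T v) <= 4^-1 * rnorm v.
  have := doubling m (g := idfun) K0 T1 TK (T v).
  rewrite /= -iterSr prednK// => h.
  have := T1 v; have := rnorm_ge0 v; have : 0 < 2 ^+ m :> R by rewrite exprn_gt0.
  move: h mK; set x := 2 ^+ m; set y := rnorm (iter _ _ _); set z := rnorm (T v).
  by move=> h mK x0 v0 zv; rewrite -(ler_pM2l x0); nra.
(* s is below 1, and yet s ^+ p stays above 1/2, hence above the norm of T^p *)
pose s : R := 1 - (2 * p%:R)^-1.
have p1 : 1 <= p%:R :> R by rewrite ler1n.
have i0 : 0 < (2 * p%:R)^-1 :> R by rewrite invr_gt0; lra.
have i1 : (2 * p%:R)^-1 <= 2^-1 :> R by rewrite lef_pV2 ?posrE; lra.
have s0 : 0 < s by rewrite /s; lra.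
have sp : 2^-1 <= s ^+ p.
  apply: (le_trans _ (bernoulli_ineq p _)); last by lra.
  have -> : p%:R * (2 * p%:R)^-1 = 2^-1 :> R by field; lra.
  lra.
exists s; first by rewrite s0 /s; lra.
have si : 0 < s^-1 by rewrite invr_gt0.
have := contractive_of_iter (normal_pair_scale si TS) (p := p) (q := 2^-1) p0.
have -> : (2^-1 < 1 :> R) by lra.
move=> /(_ erefl) h v.
have := h _ v; rewrite /= rnormZp ?(ltW si)// ler_pdivrMl//; apply => u.
rewrite iter_scale -rmorphXn/= rnormZp ?exprn_ge0 ?(ltW si)// exprVn.
rewrite ler_pdivrMl ?exprn_gt0//.
apply: le_trans (Tp u) _; rewrite mulrA ler_wpM2r ?rnorm_ge0//; lra.
Qed.

Definition opnorm (f : V -> V) : R :=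
  sup [set rnorm (f x) | x in [set x : V | rnorm x <= 1]].

Section OpNorm.
Variables (f : {linear V -> V}) (M : R).
Hypothesis fM : forall v, rnorm (f v) <= M * rnorm v.

Lemma le_opnorm v : rnorm (f v) <= opnorm f * rnorm v.
Proof.
have [/rnorm_eq0 ->|/rnorm_neq0_gt0 v0] := eqVneq (rnorm v) 0.
  by rewrite linear0 rnorm0 mulr0.
have vi : 0 <= (rnorm v)^-1 by rewrite invr_ge0 ltW.
rewrite -ler_pdivrMr// mulrC -rnormZp// -linearZ/=.
apply: ub_le_sup.
  exists `|M| => _ [x /= x1 <-]; apply: le_trans (fM x) _.
  by have := rnorm_ge0 x; have := ler_norm M; have := normr_ge0 M; nra.
by exists ((rnorm v)^-1%:C *: v) => //=; rewrite rnormZp// mulVf ?gt_eqF.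
Qed.

Lemma opnorm_le : 0 <= M -> opnorm f <= M.
Proof.
move=> M0; apply: ge_sup.
  by exists (rnorm (f 0)), 0 => //=; rewrite rnorm0.
move=> _ [x /= x1 <-]; apply: le_trans (fM x) _.
by have := rnorm_ge0 x; nra.
Qed.

Lemma opnorm_ge0 : 0 <= opnorm f.
Proof.
have [M0|M0] := leP 0 M; last first.
  have v0 (v : V) : rnorm v = 0.
    by have := fM v; have := rnorm_ge0 v; have := rnorm_ge0 (f v); nra.
  rewrite /opnorm (_ : [set _ | _ in _] = [set 0]) ?sup1//.
  apply/seteqP; split => [_ [x _ <-]|_ ->]/=; first by rewrite v0.
  by exists 0; rewrite /= ?v0 ?ler01.
apply: ub_le_sup.
  exists M => _ [x /= x1 <-]; apply: le_trans (fM x) _.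
  by have := rnorm_ge0 x; nra.
by exists 0; rewrite /= ?linear0 ?rnorm0.
Qed.
End OpNorm.

(** A bounded normal map has approximate eigenvalues of modulus its norm:
    divided by its norm, it is a contraction but not a strict one. *)
Lemma norm_in_approx_spectrum (T S : {linear V -> V}) (M d : R) :
    normal_pair T S -> (forall v, rnorm (T v) <= M * rnorm v) ->
    0 < opnorm T -> 0 < d ->
  exists k v, `|k| = (opnorm T)%:C /\ rnorm (shift T k v) < d * rnorm v.
Proof.
move=> TS TM; set N := opnorm T => N0 d0; apply: contrapT => /forallNP noapp.
have Ni : 0 < N^-1 by rewrite invr_gt0.
have NNi : N^-1%:C * N%:C = 1 :> R[i].
  by rewrite -rmorphM mulVf ?rmorph1// gt_eqF.
have := @strict_contraction (N^-1%:C \*: T) (N^-1%:C \*: S) (N^-1 * d)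
  (normal_pair_scale Ni TS) (mulr_gt0 Ni d0).
case=> [v|k v k1|r /andP[r0 r1] Tr].
- by rewrite /= rnormZp ?(ltW Ni)// ler_pdivrMl//; exact: le_opnorm TM v.
- have -> : k = N^-1%:C * (N%:C * k) by rewrite mulrA NNi mul1r.
  rewrite shift_scale rnormZp ?(ltW Ni)// -mulrA ler_pM2l//.
  have /forallNP/(_ v) := noapp (N%:C * k).
  rewrite normrM k1 mulr1 norm_real_complex gtr0_norm// => h.
  by rewrite leNgt; apply/negP => ?; apply: h.
suff NNr : N <= N * r.
  have : N * r < N * 1 by rewrite ltr_pM2l.
  by move: NNr; rewrite mulr1 => /le_lt_trans h /h; rewrite ltxx.
apply: opnorm_le => [v|]; last by rewrite mulr_ge0// ltW.
have := Tr v; rewrite /= rnormZp ?(ltW Ni)//.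
by rewrite ler_pdivrMl// mulrA.
Qed.

(** [T - k] and [T - conj k] have equal norms at [v] and differ by
    [2 i Im k]. *)
Lemma selfadjoint_shift_ge (T : {linear V -> V}) (x y : R) v :
  normal_pair T T -> `|y| * rnorm v <= rnorm (shift T (x +i* y) v).
Proof.
move=> TT.
have yI : (x +i* y) - (x +i* y)^* = (2 * y)%:C * 'i%C.
  rewrite (_ : (x +i* y)^* = x -i* y)//.
  by apply/eqP; rewrite eq_complex/=; apply/andP; split; apply/eqP; ring.
have := rnorm_leB (shift T (x +i* y)^* v) (shift T (x +i* y) v).
rewrite (TT (x +i* y)^* v) conjCK.
have -> : shift T (x +i* y)^* v - shift T (x +i* y) v =
    (2 * y)%:C *: ('i%C *: v).
  rewrite scalerA -yI /shift; move: (T v) => w; vector w v v v.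
by rewrite rnormZr rnormZu ?normCi// normrM ger0_norm// => ?; lra.
Qed.

(** The approximate eigenvalues of modulus the norm are nearly real, by
    [selfadjoint_shift_ge], so that their real parts serve. The gap [e] does
    not depend on the precision [d]. *)
Lemma selfadjoint_approx_eigen (T : {linear V -> V}) (M K : R) :
    normal_pair T T -> (forall v, rnorm (T v) <= M * rnorm v) ->
    0 <= K -> (exists v, K * rnorm v < rnorm (T v)) ->
  exists2 e, 0 < e & forall d, 0 < d ->
    exists x v, K + e <= `|x| /\ rnorm (T v - x%:C *: v) < d * rnorm v.
Proof.
move=> TT TM K0 [v0 Kv0]; pose N := opnorm T.
have KN : K < N.
  have := le_opnorm TM v0; rewrite -/N => ?.
  by have := rnorm_ge0 v0; nra.
exists ((N - K) / 2) => [|d d0]; first by lra.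
pose d' := Num.min (d / 2) ((N - K) / 2).
have d'0 : 0 < d' by rewrite lt_min; apply/andP; split; lra.
have d'd : d' <= d / 2 by rewrite ge_min lexx.
have d'N : d' <= (N - K) / 2 by rewrite ge_min lexx orbT.
have N0 : 0 < opnorm T by rewrite -/N; lra.
have [[x y] [v [kN Tv]]] := norm_in_approx_spectrum TT TM N0 d'0.
have v0' := rnorm_gt0_of_lt Tv.
have yd : `|y| < d'.
  by have := selfadjoint_shift_ge x y v TT; rewrite -(ltr_pM2r v0'); lra.
exists x, v; split.
  have : `|x +i* y| <= (`|x| + `|y|)%:C.
    have := ler_normD x%:C ('i%C * y%:C).
    rewrite normrM normCi mul1r !norm_real_complex rmorphD.
    by rewrite -(complexE (x +i* y)).
  by rewrite kN lecR => NI; have {NI} : N <= `|x| + `|y| := NI; lra.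
have -> : T v - x%:C *: v = shift T (x +i* y) v + y%:C *: ('i%C *: v).
  rewrite /shift (complexE (x +i* y)) /=; move: (T v) => w; vector w v v v.
have := rnorm_leD (shift T (x +i* y) v) (y%:C *: ('i%C *: v)).
rewrite rnormZr rnormZu ?normCi// => h; apply: le_lt_trans h _.
by nra.
Qed.

End NormAttained.

(** * Positivity in a C*-algebra *)

Section CStar.
Context (R : realType) (A : cstarAlgType R).
Implicit Types (a b c h u v w : A) (k : R[i]).

Lemma cmul_is_linear a : linear (cmul a).
Proof. by move=> k u v; rewrite cmulDr cmulZr. Qed.
HB.instance Definition _ a :=
  GRing.isLinear.Build R[i] A A *:%R (cmul a) (cmul_is_linear a).

Lemma cmulNl a b : cmul (- a) b = - cmul a b.
Proof. by rewrite -scaleN1r cmulZl scaleN1r. Qed.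

Lemma cmulBl a b c : cmul (a - b) c = cmul a c - cmul b c.
Proof. by rewrite cmulDl cmulNl. Qed.

Lemma cmulNr a b : cmul a (- b) = - cmul a b.
Proof. exact: linearN. Qed.

Lemma cmulBr a b c : cmul a (b - c) = cmul a b - cmul a c.
Proof. exact: linearB. Qed.

Lemma cstarN a : cstar (- a) = - cstar a.
Proof.
have := cstarZ (-1) a; rewrite !scaleN1r => ->.
rewrite (_ : (-1)^* = -1 :> R[i]) ?scaleN1r//.
by apply/eqP; rewrite eq_complex/= !oppr0 !eqxx.
Qed.

Lemma cstarB a b : cstar (a - b) = cstar a - cstar b.
Proof. by rewrite cstarD cstarN. Qed.

Lemma cstarZr (r : R) a : cstar (r%:C *: a) = r%:C *: cstar a.
Proof. by rewrite cstarZ conj_real. Qed.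

Lemma rnormM a b : rnorm (cmul a b) <= rnorm a * rnorm b.
Proof. by rewrite -lecR rmorphM/= -!normE cnormM. Qed.

Lemma rnorm_star_mul a : rnorm (cmul (cstar a) a) = rnorm a ^+ 2.
Proof.
by apply: (@complexI R); rewrite -!normE cnorm_star_mul normE -rmorphXn.
Qed.

Lemma rnorm_star a : rnorm (cstar a) = rnorm a.
Proof.
have le b : rnorm b <= rnorm (cstar b).
  have := rnormM (cstar b) b; rewrite rnorm_star_mul.
  have := rnorm_ge0 b; have := rnorm_ge0 (cstar b); nra.
by apply/le_anti; rewrite le -{2}(cstarK a) le.
Qed.

Definition selfadj a := cstar a = a.

Lemma selfadjN a : selfadj a -> selfadj (- a).
Proof. by move=> aa; rewrite /selfadj cstarN aa. Qed.

Lemma selfadj_star_mul a : selfadj (cmul (cstar a) a).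
Proof. by rewrite /selfadj cstarM cstarK. Qed.

Lemma selfadj_mul_star a : selfadj (cmul a (cstar a)).
Proof. by rewrite /selfadj cstarM cstarK. Qed.

Lemma rnorm_selfadj_sqr a : selfadj a -> rnorm (cmul a a) = rnorm a ^+ 2.
Proof. by move=> aa; rewrite -{1}aa rnorm_star_mul. Qed.

Lemma selfadj_normal_pair h : selfadj h -> normal_pair (cmul h) (cmul h).
Proof.
move=> hh k v.
suff E l : cmul (cstar (shift (cmul h) l v)) (shift (cmul h) l v) =
    cmul (cstar v) (cmul h (cmul h v)) - (l + l^*) *: cmul (cstar v) (cmul h v)
    + (l^* * l) *: cmul (cstar v) v.
  apply/eqP; rewrite -(@eqrXn2 _ 2)// ?rnorm_ge0// -!rnorm_star_mul !E conjCK.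
  by rewrite [k^* + k]addrC [k * k^*]mulrC.
rewrite /shift cstarB cstarZ cstarM hh cmulBl !linearB !linearZ/=.
rewrite !cmulZl -!cmulA.
move: (cmul (cstar v) (cmul h (cmul h v))) (cmul (cstar v) (cmul h v))
  (cmul (cstar v) v) => x y z.
by vector x y z z.
Qed.

(** For self-adjoint [h], this says that the spectrum of [h] is at least [- e]:
    the spectrum of [t - h] then lies between [0] and [t + e]. The scalar [t]
    is not in [A], so [t - h] is taken as an operator on [A]. In this form,
    sums of positive elements are positive by the triangle inequality. *)
Definition lower (e : R) h :=
  exists2 t, rnorm h <= t &
    forall v, rnorm (t%:C *: v - cmul h v) <= (t + e) * rnorm v.

Lemma lowerW e e' h : e <= e' -> lower e h -> lower e' h.
Proof.
move=> ee' [t ht th]; exists t => // v; apply: le_trans (th v) _.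
by rewrite ler_wpM2r ?rnorm_ge0// lerD2l.
Qed.

Lemma lowerD e e' h h' : lower e h -> lower e' h' -> lower (e + e') (h + h').
Proof.
move=> [t ht th] [t' ht' th']; exists (t + t') => [|v].
  by apply: le_trans (rnorm_leD _ _) _; lra.
have -> : (t + t')%:C *: v - cmul (h + h') v =
    (t%:C *: v - cmul h v) + (t'%:C *: v - cmul h' v).
  by rewrite rmorphD cmulDl scalerDl opprD addrACA.
apply: le_trans (rnorm_leD _ _) _.
by have := th v; have := th' v; lra.
Qed.

Lemma lowerZ r e h : 0 <= r -> lower e h -> lower (r * e) (r%:C *: h).
Proof.
move=> r0 [t ht th]; exists (r * t) => [|v].
  by rewrite rnormZp// ler_wpM2l.
by rewrite rmorphM -scalerA cmulZl -scalerBr rnormZp// -mulrDr -mulrA ler_wpM2l.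
Qed.

Lemma lower_norm h : lower (rnorm h) h.
Proof.
exists (rnorm h) => // v; apply: le_trans (rnorm_leB _ _) _.
by rewrite rnormZp ?rnorm_ge0// mulrDl lerD2l rnormM.
Qed.

Lemma lower_approx_eigen e h (y d : R) v : lower e h ->
  rnorm (cmul h v - y%:C *: v) < d * rnorm v -> - e - d <= y.
Proof.
move=> [t ht th] hv.
have v0 := rnorm_gt0_of_lt hv.
have : `|t - y| * rnorm v < (t + e + d) * rnorm v.
  rewrite -rnormZr.
  have -> : (t - y)%:C *: v = (t%:C *: v - cmul h v) + (cmul h v - y%:C *: v).
    by rewrite rmorphB/= scalerBl addrA subrK.
  apply: le_lt_trans (rnorm_leD _ _) _.
  by have := th v; lra.
by rewrite ltr_pM2r//; have := ler_norm (t - y); lra.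
Qed.

(** The norm of [t - h] is an approximate eigenvalue up to sign, and the sign
    is [+] since [h] is at most [t]. *)
Lemma notlower_approx_eigen e h : selfadj h -> 0 <= e -> ~ lower e h ->
  exists2 r, 0 < r & forall d, 0 < d -> exists y v,
    [/\ y <= - e - r, rnorm v = 1 & rnorm (cmul h v - y%:C *: v) < d].
Proof.
move=> hh e0 nl; pose t := rnorm h.
have t0 : 0 <= t by exact: rnorm_ge0.
pose T := (t%:C \*: idfun \- cmul h) : {linear A -> A}.
have ST k v : shift T k v = - shift (cmul h) (t%:C - k) v.
  by rewrite /shift/=; move: (cmul h v) => w; vector v w w w.
have TT : normal_pair T T.
  move=> k v; rewrite !ST !rnormN (selfadj_normal_pair hh).
  by rewrite raddfB/= conj_real.
have TM v : rnorm (T v) <= (2 * t) * rnorm v.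
  apply: le_trans (rnorm_leB _ _) _; rewrite rnormZp//.
  by have := rnormM h v; rewrite -/t/=; lra.
have [] := @selfadjoint_approx_eigen _ _ T _ (t + e) TT TM.
- by rewrite addr_ge0.
- apply: contrapT => /forallNP nv; apply: nl; exists t => // v.
  by rewrite leNgt; apply/negP; exact: nv.
move=> r r0 Tr; exists r => // d d0.
(* precision r rules out the sign -, precision d is the one required *)
have d'0 : 0 < Num.min d r by rewrite lt_min d0.
have [x [v [xr xv]]] := Tr _ d'0.
have v0 := rnorm_gt0_of_lt xv.
have dr : Num.min d r <= r by rewrite ge_min lexx orbT.
have dd : Num.min d r <= d by rewrite ge_min lexx.
have xE : T v - x%:C *: v = - (cmul h v - (t - x)%:C *: v).
  by rewrite /= rmorphB/=; move: (cmul h v) => w; vector v w w w.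
rewrite xE rnormN in xv.
have x0 : 0 < x.
  rewrite ltNge; apply/negP => x0; rewrite ler0_norm// in xr.
  have := rnorm_subadd ((t - x)%:C *: v) (cmul h v).
  rewrite rnormB rnormZp; last by lra.
  have := rnormM h v; rewrite -/t.
  by nra.
rewrite gtr0_norm// in xr.
exists (t - x), ((rnorm v)^-1%:C *: v); split; first by lra.
  by rewrite rnormZp ?mulVf ?invr_ge0 ?rnorm_ge0// gt_eqF.
rewrite linearZ/= scalerA mulrC -scalerA -scalerBr.
rewrite rnormZp ?invr_ge0 ?rnorm_ge0// ltr_pdivrMl// mulrC.
by apply: lt_le_trans xv _; rewrite ler_wpM2r// ltW.
Qed.

(** Here too the norm is an approximate eigenvalue up to sign. *)
Lemma rnorm_le_of_lower e h : selfadj h -> 0 <= e ->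
  lower e h -> lower e (- h) -> rnorm h <= e.
Proof.
move=> hh e0 lh lNh; rewrite leNgt; apply/negP => eh.
have [|r r0 Hr] := @selfadjoint_approx_eigen _ _ (cmul h) (rnorm h) e
    (selfadj_normal_pair hh) (rnormM h) e0.
  by exists h; rewrite rnorm_selfadj_sqr// expr2; have := rnorm_ge0 h; nra.
have [|x [v [xr xv]]] := Hr (r / 2); first by lra.
have [x0|x0] := leP 0 x.
  have : rnorm (cmul (- h) v - (- x)%:C *: v) < r / 2 * rnorm v.
    by rewrite cmulNl rmorphN/= scaleNr -opprD rnormN.
  by move/(lower_approx_eigen lNh); rewrite ger0_norm// in xr; lra.
by move/(lower_approx_eigen lh): xv; rewrite ltr0_norm// in xr; lra.
Qed.

(** [a^2 + s^2] factors as [(a - i s) (a + i s)], where both factors are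
    bounded below by [s]; hence [a^2] has no approximate eigenvalue
    [- s^2]. *)
Lemma lower_sqr a : selfadj a -> lower 0 (cmul a a).
Proof.
move=> aa; apply: contrapT => /notlower_approx_eigen[].
- by rewrite /selfadj cstarM aa.
- by [].
move=> r r0 /(_ r r0)[y [v [yr v1]]]; rewrite ltNge => /negP; apply.
pose s := Num.sqrt (- y).
have ys : y%:C = (0 +i* s) ^+ 2.
  apply/eqP; rewrite expr2 eq_complex/=.
  apply/andP; split; apply/eqP; last by ring.
  by rewrite mul0r sub0r -expr2 sqr_sqrtr; lra.
have -> : cmul (cmul a a) v - y%:C *: v =
    shift (cmul a) (0 +i* s) (shift (cmul a) (0 +i* (- s)) v).
  rewrite (_ : 0 +i* (- s) = - (0 +i* s)); last first.
    by apply/eqP; rewrite eq_complex/= ?oppr0 !eqxx.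
  by rewrite shift_mul_opp ys /shift/= cmulA.
have := selfadjoint_shift_ge 0 s (shift (cmul a) (0 +i* (- s)) v)
  (selfadj_normal_pair aa).
have := selfadjoint_shift_ge 0 (- s) v (selfadj_normal_pair aa).
rewrite normrN v1 mulr1 ger0_norm ?sqrtr_ge0// => h1 h2; apply: le_trans h2.
apply: (@le_trans _ _ (s * s)); last by rewrite ler_wpM2l// sqrtr_ge0.
by rewrite -expr2 sqr_sqrtr; lra.
Qed.

(** [c^* c] and [c c^*] have the same nonzero approximate eigenvalues: [c^*]
    maps approximate eigenvectors of the second to those of the first, and it
    is bounded below on them because the eigenvalue is away from 0. *)
Lemma lowerN_mul_star e c : 0 <= e ->
  lower e (- cmul (cstar c) c) -> lower e (- cmul c (cstar c)).
Proof.
move=> e0 lc; apply: contrapT => /notlower_approx_eigen[].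
- exact/selfadjN/selfadj_mul_star.
- by [].
move=> r r0 Hr.
set n := rnorm c; have n0 : 0 <= n by exact: rnorm_ge0.
pose d := Num.min (r / 2) (r ^+ 2 / (4 * (n ^+ 2 + 1))).
have m0 : 0 < 4 * (n ^+ 2 + 1) by nra.
have d0 : 0 < d.
  by rewrite lt_min divr_gt0//= divr_gt0// exprn_gt0.
have d1 : d <= r / 2 by rewrite ge_min lexx.
have d2 : d * (4 * (n ^+ 2 + 1)) <= r ^+ 2.
  by rewrite -ler_pdivlMr// ge_min lexx orbT.
have [y [w [yr w1 yw]]] := Hr d d0.
pose z := cmul (cstar c) w.
have h1 : rnorm (cmul (- cmul (cstar c) c) z - y%:C *: z) <= n * d.
  have -> : cmul (- cmul (cstar c) c) z - y%:C *: z =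
      cmul (cstar c) (cmul (- cmul c (cstar c)) w - y%:C *: w).
    by rewrite !cmulNl cmulBr cmulNr cmulZr /z -!cmulA.
  apply: le_trans (rnormM _ _) _; rewrite rnorm_star ler_wpM2l// ltW//.
have h2 : r / 2 <= n * rnorm z.
  apply: (le_trans _ (rnormM _ _)).
  have := rnorm_subadd (y%:C *: w) (- cmul c z).
  rewrite rnormB rnormN rnormZr w1 mulr1 ltr0_norm; last by lra.
  move: yw; rewrite cmulNl -cmulA -/z. lra.
suff : - e - r / 2 <= y by lra.
apply: lower_approx_eigen lc _; apply: le_lt_trans h1 _.
have z0 : 0 < rnorm z by have := rnorm_ge0 z; nra.
rewrite -(ltr_pM2l r0).
have s1 : n * d * r <= n * d * (2 * (n * rnorm z)).
  by rewrite ler_wpM2l ?mulr_ge0 ?(ltW d0)//; lra.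
have s2 : d * (4 * (n ^+ 2 + 1)) * rnorm z <= r ^+ 2 * rnorm z.
  by rewrite ler_wpM2r ?(ltW z0).
have s3 : 0 < d * rnorm z by rewrite mulr_gt0.
by move: s1 s2; lra.
Qed.

(** Twice the real and imaginary parts of [c], up to sign. *)
Lemma cartesian c :
  let p := c + cstar c in let q := 'i%C *: (c - cstar c) in
  [/\ selfadj p, selfadj q,
      cmul p p + cmul q q = 2%:C *: (cmul (cstar c) c + cmul c (cstar c)) &
      2%:C *: c = p - 'i%C *: q].
Proof.
move=> p q; rewrite {}/p {}/q.
have ii : 'i%C * 'i%C = -1 :> R[i] by rewrite -expr2 sqr_i.
split.
- by rewrite /selfadj cstarD cstarK addrC.
- rewrite /selfadj cstarZ cstarB cstarK (_ : 'i%C^* = - 'i%C).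
    by rewrite scaleNr -scalerN opprB.
  by apply/eqP; rewrite eq_complex/= ?oppr0 !eqxx.
- rewrite !cmulZl !cmulZr scalerA ii !cmulDl !cmulNl !cmulDr !cmulNr.
  rewrite rmorph_nat.
  move: (cmul c c) (cmul c (cstar c)) (cmul (cstar c) c)
    (cmul (cstar c) (cstar c)) => x y z t.
  by vector x y z t.
- rewrite scalerA ii rmorph_nat; move: c (cstar c) => x y; vector x y x x.
Qed.

(** Positivity of [b^* b]. If [v] is an approximate eigenvector of [b^* b] for
    some [y < 0], then so is the self-adjoint [u = v v^*], and [c = b u]
    satisfies [c^* c ~ y u^2 <= 0]. Then [c c^*] is also nearly nonpositive,
    while [c^* c + c c^*] is a sum of squares of self-adjoint elements. So [c]
    is nearly 0, against [|c|^2 = |c^* c| ~ - y]. *)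
Lemma lower_star_mul b : lower 0 (cmul (cstar b) b).
Proof.
apply: contrapT => /notlower_approx_eigen[].
- exact: selfadj_star_mul.
- by [].
move=> r r0 Hr; pose d := r / 6; have d0 : 0 < d by rewrite divr_gt0.
have [y [v [yr v1 yv]]] := Hr d d0.
pose u := cmul v (cstar v); have uu : selfadj u by exact: selfadj_mul_star.
have u1 : rnorm u = 1.
  by rewrite /u -{1}(cstarK v) rnorm_star_mul rnorm_star v1 expr1n.
pose c := cmul b u.
pose f := y%:C *: cmul u u - cmul (cstar c) c.
have fd : rnorm f <= d.
  have -> : f = - cmul u (cmul (cmul (cmul (cstar b) b) v - y%:C *: v) (cstar v)).
    rewrite /f /c cstarM uu cmulBl cmulBr opprB cmulZl cmulZr -/u.
    by rewrite -!cmulA.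
  rewrite rnormN; apply: le_trans (rnormM _ _) _; rewrite u1 mul1r.
  by apply: le_trans (rnormM _ _) _; rewrite rnorm_star v1 mulr1 ltW.
have l1 : lower d (- cmul (cstar c) c).
  have -> : - cmul (cstar c) c = (- y)%:C *: cmul u u + f.
    by rewrite /f rmorphN/= scaleNr addKr.
  have -> : d = - y * 0 + d by rewrite mulr0 add0r.
  apply: lowerD; first by apply: lowerZ; [lra|exact: lower_sqr].
  exact: lowerW fd (lower_norm _).
have l2 := lowerN_mul_star (ltW d0) l1.
have [pp qq pq cE] := cartesian c.
set p := c + cstar c in pp pq cE; set q := 'i%C *: (c - cstar c) in qq pq cE.
have l3 : lower (4 * d) (- (cmul p p + cmul q q)).
  rewrite pq -scalerN opprD (_ : 4 * d = 2 * (d + d)); last by ring.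
  by apply: lowerZ => //; exact: lowerD.
have bound x x' : selfadj x -> selfadj x' ->
    cmul x x + cmul x' x' = cmul p p + cmul q q -> rnorm x ^+ 2 <= 4 * d.
  move=> xx xx' E; rewrite -rnorm_selfadj_sqr//.
  apply: rnorm_le_of_lower.
  - by rewrite /selfadj cstarM xx.
  - by lra.
  - by apply: lowerW (lower_sqr xx); lra.
  - have -> : - cmul x x = - (cmul p p + cmul q q) + cmul x' x'.
      by rewrite -E opprD subrK.
    by rewrite -[4 * d]addr0; apply: lowerD => //; exact: lower_sqr.
have p4 := bound p q pp qq erefl.
have q4 := bound q p qq pp (addrC _ _).
have c2 : 2 * rnorm c <= rnorm p + rnorm q.
  by rewrite -rnormZp// cE -(rnormZu q (normCi R)); exact: rnorm_leB.
have c4 : rnorm c ^+ 2 <= 4 * d.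
  have : (2 * rnorm c) ^+ 2 <= (rnorm p + rnorm q) ^+ 2.
    by rewrite lerXn2r// nnegrE ?addr_ge0 ?mulr_ge0 ?rnorm_ge0.
  by have := sqr_ge0 (rnorm p - rnorm q); move: p4 q4; rewrite !expr2; lra.
have := rnorm_subadd (y%:C *: cmul u u) (cmul (cstar c) c).
rewrite rnorm_star_mul rnormZr rnorm_selfadj_sqr// u1 expr1n mulr1 -/f.
rewrite ltr0_norm; last by lra.
by move: c4 fd yr; rewrite /d; lra.
Qed.

Lemma rnorm_sqr_le_sum c d :
  rnorm c ^+ 2 <= rnorm (cmul (cstar c) c + cmul (cstar d) d).
Proof.
set h := _ + _; rewrite -rnorm_star_mul; apply: rnorm_le_of_lower.
- exact: selfadj_star_mul.
- exact: rnorm_ge0.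
- exact: lowerW (rnorm_ge0 _) (lower_star_mul _).
- have -> : - cmul (cstar c) c = - h + cmul (cstar d) d.
    by rewrite /h opprD subrK.
  rewrite -[rnorm h]addr0 -(rnormN h).
  by apply: lowerD; [exact: lower_norm | exact: lower_star_mul].
Qed.

End CStar.

(** * Hilbert modules *)

Section Hilbert.
Context (R : realType) (A : cstarAlgType R) (H : hilbertModType A).
Implicit Types (x y z : H) (a : A) (k : R[i]).

Lemma rnorm_hinner x : rnorm (hinner x x) = rnorm x ^+ 2.
Proof.
apply: (@complexI R); rewrite rmorphXn/= -!normE hnormE.
by rewrite sqrtCK.
Qed.

Lemma hinnerNr x y : hinner x (- y) = - hinner x y.
Proof. by rewrite -scaleN1r hinnerZ scaleN1r. Qed.

Lemma hinnerBr x y z : hinner x (y - z) = hinner x y - hinner x z.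
Proof. by rewrite hinnerD hinnerNr. Qed.

Lemma hinnerDl x y z : hinner (x + y) z = hinner x z + hinner y z.
Proof. by rewrite hinnerC hinnerD cstarD -!hinnerC. Qed.

Lemma hinnerNl x y : hinner (- x) y = - hinner x y.
Proof. by rewrite hinnerC hinnerNr cstarN -hinnerC. Qed.

Lemma hinnerBl x y z : hinner (x - y) z = hinner x z - hinner y z.
Proof. by rewrite hinnerDl hinnerNl. Qed.

Lemma hinnerZl k x y : hinner (k *: x) y = k^* *: hinner x y.
Proof. by rewrite hinnerC hinnerZ cstarZ -hinnerC. Qed.

Lemma hinner_ractl x y a : hinner (ract x a) y = cmul (cstar a) (hinner x y).
Proof. by rewrite hinnerC hinner_ract cstarM -hinnerC. Qed.

(** The usual proof expands [<z, z> >= 0] for [z = |x|^2 y - x <x, y>]. The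
    positive summand [<z, z>] is then dropped at the level of norms, by
    [rnorm_sqr_le_sum]. *)
Lemma cauchy_schwarz x y : rnorm (hinner x y) <= rnorm x * rnorm y.
Proof.
have [P PE] : exists P, P = rnorm x ^+ 2 by exists (rnorm x ^+ 2).
pose c := hinner x y.
have P0 : 0 <= P by rewrite PE sqr_ge0.
have cs : cstar c = hinner y x by rewrite -hinnerC.
have [b bE] := hinner_ge0 x.
pose z := P%:C *: y - ract x c.
have [d dE] := hinner_ge0 z.
have zE : hinner z z + (2 * P)%:C *: cmul (cstar c) c =
    (P ^+ 2)%:C *: hinner y y + cmul (cstar (cmul b c)) (cmul b c).
  rewrite cstarM -cmulA (cmulA (cstar b)) -bE.
  rewrite /z hinnerBl !hinnerBr !hinnerZl !hinnerZ conj_real !hinner_ract.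
  rewrite !hinner_ractl -cs -/c -cmulA.
  move: (hinner y y) (cmul (cstar c) c)
    (cmul (cstar c) (cmul (hinner x x) c)) => q r s.
  by vector q r s s.
have low : 2 * P * rnorm c ^+ 2 <= P ^+ 2 * rnorm y ^+ 2 + P * rnorm c ^+ 2.
  pose l := Num.sqrt (2 * P).
  have l2 : l * l = 2 * P by rewrite -expr2 sqr_sqrtr ?mulr_ge0.
  have := rnorm_sqr_le_sum (l%:C *: c) d.
  rewrite rnormZp ?sqrtr_ge0// exprMn [l ^+ 2]expr2 l2 cstarZr.
  rewrite cmulZl cmulZr scalerA -rmorphM l2 -dE addrC zE => h; apply: le_trans h _.
  apply: le_trans (rnorm_leD _ _) _; apply: lerD.
    by rewrite rnormZp ?exprn_ge0// rnorm_hinner.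
  rewrite rnorm_star_mul; have bP : rnorm b ^+ 2 = P.
    by rewrite -rnorm_star_mul -bE rnorm_hinner PE.
  by rewrite -bP -exprMn lerXn2r ?nnegrE ?mulr_ge0 ?rnorm_ge0// rnormM.
have [x0|x0] := eqVneq (rnorm x) 0.
  rewrite (rnorm_eq0 x0) rnorm0 mul0r -(scale0r (0 : H)) hinnerZl conjC0.
  by rewrite scale0r rnorm0.
have P1 : 0 < P by rewrite lt_neqAle P0 andbT eq_sym PE expf_neq0.
have : rnorm c ^+ 2 <= (rnorm x * rnorm y) ^+ 2.
  by rewrite exprMn -PE -(ler_pM2l P1); lra.
by rewrite ler_pXn2r// nnegrE ?mulr_ge0 ?rnorm_ge0.
Qed.

Lemma hinner_inj x y : (forall z, hinner z x = hinner z y) -> x = y.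
Proof.
move=> xy; apply/eqP; rewrite -subr_eq0; apply/eqP/hinner_eq0.
by rewrite hinnerBr xy subrr.
Qed.

Lemma is_adjoint_sym (T S : H -> H) : is_adjoint T S -> is_adjoint S T.
Proof. by move=> TS x y; rewrite hinnerC -TS -hinnerC. Qed.

Lemma adjointable_is_linear (T : adjointable H) : linear T.
Proof.
move=> k x y; apply: hinner_inj => z.
have TS := is_adjoint_sym (adjoint_funP T).
by rewrite -TS !hinnerD !hinnerZ -!TS.
Qed.
HB.instance Definition _ (T : adjointable H) :=
  GRing.isLinear.Build R[i] H H *:%R (adj_fun T) (adjointable_is_linear T).

End Hilbert.

Lemma geometric_limit (R : realType) (V : completeNormedModType R[i])
    (x : nat -> V) :
    (forall n, rnorm (x n.+1 - x n) <= 3^-1 ^+ n.+1) ->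
  exists l, forall n, rnorm (l - x n) <= 3^-1 ^+ n / 2.
Proof.
move=> xS; set q : R := 3^-1; have q0 : 0 < q by rewrite invr_gt0.
have xm n m : rnorm (x (n + m)%N - x n) <= q ^+ n / 2 - q ^+ (n + m) / 2.
  elim: m => [|m IH]; first by rewrite addn0 !subrr rnorm0.
  have := rnorm_leD (x (n + m).+1 - x (n + m)%N) (x (n + m)%N - x n).
  rewrite subrKA addnS => h; apply: le_trans h _.
  have := xS (n + m)%N; rewrite -/q.
  have -> : q ^+ (n + m).+1 = 3^-1 * q ^+ (n + m) by rewrite exprS.
  by lra.
have xn n m : (n <= m)%N -> rnorm (x m - x n) <= q ^+ n / 2.
  move=> /subnKC <-; apply: le_trans (xm _ _) _.
  by rewrite gerBl divr_ge0// exprn_ge0// ltW.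
have qc : (fun n => q ^+ n) @ \oo --> (0 : R).
  by apply: cvg_expr; rewrite ger0_norm ?ltW// /q; lra.
have qe (e : R[i]) : 0 < e -> exists n, (q ^+ n / 2)%:C < e.
  move=> e0; have eR : e = (complex.Re e)%:C by rewrite RRe_real// gtr0_real.
  move: e0; rewrite eR (ltcR 0) => e0.
  have [n _ /(_ n (leqnn n))] := (cvgrPdist_lt _ _).1 qc _ e0.
  rewrite sub0r normrN ger0_norm ?exprn_ge0 ?(ltW q0)// => qn.
  exists n; rewrite ltcR.
  have : 0 <= q ^+ n by rewrite exprn_ge0// ltW.
  by lra.
have /cauchy_cvg xl : cauchy (x @ \oo).
  apply: cauchy_exP => e e0; have [n ne] := qe e e0.
  exists (x n); exists n => // m /= nm.
  by rewrite -ball_normE/= normE rnormB (le_lt_trans _ ne)// lecR xn.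
exists (lim (x @ \oo)) => n; set l := lim _.
apply/ler_addgt0Pr => e e0.
have e0' : 0 < e%:C :> R[i] by rewrite (ltcR 0).
have [m _ Hm] := (cvgrPdist_lt _ _).1 xl _ e0'.
have := Hm (maxn m n) (leq_maxl _ _); rewrite normE ltcR => h1.
have := xn _ _ (leq_maxr m n) => h2.
have := rnorm_leD (l - x (maxn m n)) (x (maxn m n) - x n).
by rewrite subrKA -/q; lra.
Qed.

(** * Adjointable operators *)

Section Operators.
Context (R : realType) (A : cstarAlgType R) (H : hilbertModType A).
Implicit Types (x y z : H).

Lemma unbounded_large (f : {linear H -> H}) (B : R) :
  ~ (exists M, forall v, rnorm (f v) <= M * rnorm v) ->
  exists2 y, rnorm y <= 1 & B < rnorm (f y).
Proof.
move=> fNb; apply: contrapT => noy; apply: fNb; exists B => v.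
have [/rnorm_eq0 ->|v0] := eqVneq (rnorm v) 0.
  by rewrite linear0 rnorm0 mulr0.
have v1 := rnorm_neq0_gt0 v0.
rewrite leNgt; apply/negP => Bv; apply: noy.
exists ((rnorm v)^-1%:C *: v); first by rewrite rnormZp ?mulVf// invr_ge0 ltW.
by rewrite linearZ/= rnormZp ?invr_ge0 ?(ltW v1)// mulrC ltr_pdivlMr.
Qed.

(** One step of a gliding hump. Of [x + z] and [x - z], with [z] of norm
    [3^-(n+1)] along [T y], one has an inner product with [T y] at least that
    of [z], since the two inner products differ by twice the latter. *)
Lemma hump_step (T : adjointable H) (n : nat) x :
    ~ (exists M, forall v, rnorm (T v) <= M * rnorm v) ->
  exists x', rnorm (x' - x) <= 3^-1 ^+ n.+1 /\
    exists y, [/\ rnorm y <= 1, 2 * 3 ^+ n.+1 * n%:R < rnorm (T y) &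
      3^-1 ^+ n.+1 * rnorm (T y) <= rnorm (hinner (T y) x')].
Proof.
move=> Tub; have [y y1 Ty] := unbounded_large (2 * 3 ^+ n.+1 * n%:R) Tub.
set e : R := 3^-1 ^+ n.+1; have e0 : 0 < e by rewrite exprn_gt0// invr_gt0.
have Ty0 : 0 < rnorm (T y).
  by apply: le_lt_trans Ty; rewrite !mulr_ge0// exprn_ge0.
pose z := (e / rnorm (T y))%:C *: T y.
have c0 : 0 <= e / rnorm (T y) by rewrite divr_ge0// ltW.
have ze : rnorm z <= e by rewrite rnormZp// divfK// gt_eqF.
have zT : rnorm (hinner (T y) z) = e * rnorm (T y).
  rewrite hinnerZ rnormZp// rnorm_hinner expr2 mulrA divfK// gt_eqF//.
have [h|h] := leP (e * rnorm (T y)) (rnorm (hinner (T y) (x + z))).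
  by exists (x + z); split; [rewrite addrC addKr | exists y].
exists (x - z); split; first by rewrite addrC addKr rnormN.
exists y; split=> //.
have := rnorm_leB (hinner (T y) (x + z)) (hinner (T y) (x - z)).
have -> : hinner (T y) (x + z) - hinner (T y) (x - z) = 2%:C *: hinner (T y) z.
  rewrite hinnerBr hinnerD rmorph_nat.
  by move: (hinner (T y) x) (hinner (T y) z) => u v; vector u v v v.
by rewrite rnormZp// zT; lra.
Qed.

(** Otherwise the humps add up to a limit [l] with [<T y, l>] arbitrarily large
    for suitable [y] in the unit ball, although [<T y, l> = <y, T^* l>]. The
    ratio 3 of the humps leaves at each step half of the last hump after all
    the later ones. *)
Lemma adjointable_bounded (T : adjointable H) :
  exists M, forall v, rnorm (T v) <= M * rnorm v.
Proof.
apply: contrapT => Tub.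
have [f Hf] := choice (fun p : nat * H => hump_step p.1 p.2 Tub).
pose x := fix x n := if n is m.+1 then f (m, x m) else 0.
have [l xl] : exists l, forall n, rnorm (l - x n) <= 3^-1 ^+ n / 2.
  by apply: geometric_limit => n; have [] := Hf (n, x n).
pose s := rnorm (adjoint_fun T l); pose n := (Num.truncn s).+1.
have sn : s < n%:R by rewrite truncnS_gt.
have [_ [y [y1 Ty]]] := Hf (n, x n).
rewrite -[f _]/(x n.+1) /= in Ty *.
move: (xl n.+1); set e : R := 3^-1 ^+ n.+1 => le Txe.
have e0 : 0 < e by rewrite exprn_gt0// invr_gt0.
have e3 : e * 3 ^+ n.+1 = 1 by rewrite -exprMn mulVf ?expr1n.
have h1 : rnorm (hinner (T y) l) <= s.
  rewrite adjoint_funP; apply: le_trans (cauchy_schwarz _ _) _.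
  by rewrite -/s ler_piMl// rnorm_ge0.
have h2 : rnorm (hinner (T y) (l - x n.+1)) <= rnorm (T y) * (e / 2).
  apply: le_trans (cauchy_schwarz _ _) _.
  by rewrite ler_wpM2l// rnorm_ge0.
have := rnorm_subadd (hinner (T y) (x n.+1)) (hinner (T y) l).
rewrite rnormB -hinnerBr => h3.
have : e * (2 * 3 ^+ n.+1 * n%:R) < e * rnorm (T y) by rewrite ltr_pM2l.
have -> : e * (2 * 3 ^+ n.+1 * n%:R) = 2 * (e * 3 ^+ n.+1) * n%:R by ring.
by rewrite e3; lra.
Qed.

Lemma normal_adjoint_pair (T : adjointable H) :
  normal_operator T -> normal_pair T (adjoint T).
Proof.
move=> nT k v.
have TS := adjoint_funP T.
have ST := is_adjoint_sym TS.
have TTE : T (adjoint_fun T v) = adjoint_fun T (T v).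
  by have := congr1 (fun U : adjointable H => U v) nT.
suff E : hinner (shift T k v) (shift T k v) =
    hinner (shift (adjoint T) k^* v) (shift (adjoint T) k^* v).
  by apply/eqP; rewrite -(@eqrXn2 _ 2)// ?rnorm_ge0// -!rnorm_hinner E.
rewrite /shift/= !hinnerBl !hinnerBr !hinnerZl !hinnerZ !TS !ST conjCK TTE.
move: (hinner v (adjoint_fun T (T v))) (hinner v (T v))
  (hinner v (adjoint_fun T v)) (hinner v v) => a b c d.
by vector a b c d.
Qed.

End Operators.

Theorem corollary3p6 (R : realType) (A : cstarAlgType R) (H : hilbertModType A)
    (T : adjointable H) (normT : normal_operator T) :
  numerical_radius T = operator_norm T.
Proof.
have [M TM] := adjointable_bounded T.
rewrite -[operator_norm T]/(opnorm T) /numerical_radius.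
set N := opnorm T; set E := [set _ | _ in _].
have NT x : rnorm (T x) <= N * rnorm x by exact: le_opnorm TM x.
have N0 : 0 <= N by exact: opnorm_ge0 TM.
have EN r : E r -> r <= N.
  move=> [x /= x1 <-]; apply: le_trans (cauchy_schwarz _ _) _.
  by have := NT x; rewrite x1 !mulr1.
have [[u u1]|noE] := pselect (exists u : H, rnorm u = 1); last first.
  have E0 : E = set0.
    by apply/seteqP; split => // r [x /= x1 _]; case: noE; exists x.
  have x0 (x : H) : rnorm x = 0.
    apply/eqP; apply: contrapT => /negP x0; apply: noE.
    exists ((rnorm x)^-1%:C *: x).
    by rewrite rnormZp ?invr_ge0 ?rnorm_ge0// mulVf.
  rewrite E0 sup0; apply/le_anti; rewrite N0/=.
  by apply: (opnorm_le (M := 0)) => // v; rewrite x0 mul0r.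
have wE x : rnorm (hinner (T x) x) <= sup E * rnorm x ^+ 2.
  have [/rnorm_eq0 ->|x0] := eqVneq (rnorm x) 0.
    rewrite -[X in hinner _ X](scale0r (0 : H)) hinnerZ scale0r.
    by rewrite !rnorm0 expr0n mulr0.
  have x1 := rnorm_neq0_gt0 x0.
  have xi : 0 <= (rnorm x)^-1 by rewrite invr_ge0 ltW.
  have [y xy y1] : exists2 y, x = (rnorm x)%:C *: y & rnorm y = 1.
    exists ((rnorm x)^-1%:C *: x); last by rewrite rnormZp// mulVf.
    by rewrite scalerA -rmorphM divff// scale1r.
  have h : rnorm (hinner (T y) y) <= sup E.
    by apply: ub_le_sup; [exists N => r /EN | exists y].
  rewrite {1 2}xy linearZ/= hinnerZl hinnerZ scalerA conj_real -rmorphM.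
  rewrite rnormZp ?mulr_ge0 ?rnorm_ge0// -expr2 [leRHS]mulrC.
  by rewrite ler_wpM2l ?sqr_ge0.
have w0 : 0 <= sup E.
  by have := wE u; rewrite u1 expr1n mulr1; apply: le_trans; exact: rnorm_ge0.
apply/le_anti/andP; split.
  by apply: ge_sup => //; exists (rnorm (hinner (T u) u)), u.
rewrite leNgt; apply/negP => wN.
have d0 : 0 < N - sup E by rewrite subr_gt0.
have N1 : 0 < opnorm T by exact: le_lt_trans w0 wN.
(* |<(T - k) v, v>| >= (|k| - w) |v|^2, so T - k is bounded below by N - w *)
have [k [v [kN]]] :=
  norm_in_approx_spectrum (normal_adjoint_pair normT) TM N1 d0.
rewrite ltNge => /negP; apply.
have [->|/rnorm_neq0_gt0 v1] := eqVneq (rnorm v) 0.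
  by rewrite mulr0 rnorm_ge0.
rewrite -(ler_pM2r v1); apply: le_trans (cauchy_schwarz _ _).
rewrite /shift hinnerBl hinnerZl.
have := rnorm_subadd (k^* *: hinner v v) (hinner (T v) v).
rewrite rnormB rnormZ norm_conjC kN /= rnorm_hinner -/N.
by have := wE v; rewrite expr2; lra.
Qed.
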